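(* Let $p$ be a prime and let $G$ be a finite abelian $p$-group of order $p^{n}$, with Schur multiplier of order $|M(G)|=p^{\frac{n(n-1)}{2}-t}$, and with Frattini subgroup $\Phi(G)$ of order $p^{a}$. Let $m=an-\frac{a(a+1)}{2}-t$ (so that, when $a\geq1$, $n=\frac{a(a+1)+2t+2m}{2a}$). Suppose that $\exp(G)=p^{a-m+1}$. Then $$G\cong \mathbb{Z}_{p^{a-m+1}}\oplus\mathbb{Z}_{p^{m+1}}\oplus \underbrace{\mathbb{Z}_p\oplus\cdots\oplus\mathbb{Z}_p}_{n-a-2\text{ copies}}.$$
   Context: $\mathbb{Z}_{q}$ denotes the cyclic group of order $q$. The Schur multiplier of a group $G$ with free presentation $G\cong F/R$ ($F$ free) is $M(G)=(R\cap F')/[R,F]$. $\Phi(G)$ is the Frattini subgroup of $G$, and $\exp(G)$ is the exponent of $G$.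
   Formalization: The formal statement assumes n ≥ a+2, i.e. G is not cyclic: for a nontrivial cyclic G all hypotheses hold with m = 0, but the conclusion asks for n-a-2 = -1 copies of Z_p, which is undefined. *)

(* Defs.v *)
From HB Require Import structures.
From mathcomp Require Import all_boot all_order all_algebra all_fingroup all_solvable.
From Stdlib Require Import Relations.

Set Implicit Arguments.
Unset Strict Implicit.
Unset Printing Implicit Defensive.

Import GRing.Theory.

(* Free groups, presented as words modulo free reduction.                    *)
(* A letter (x, true) stands for the generator x, (x, false) for x^-1.       *)
(* Subgroups of the free group are represented by predicates on words that   *)
(* are (by construction) invariant under free equivalence.                   *)
Section FreeWords.
Variable X : eqType.

Definition word := seq (X * bool).

Definition winv (w : word) : word := rev (map (fun l => (l.1, ~~ l.2)) w).

Inductive red1 : word -> word -> Prop :=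
  | Red1 (u v : word) (x : X) (b : bool) :
      red1 (u ++ (x, b) :: (x, ~~ b) :: v) (u ++ v).

Definition freeq : word -> word -> Prop := clos_refl_sym_trans word red1.

Definition wcomm (u v : word) : word := winv u ++ winv v ++ u ++ v.

(* w lies in the derived subgroup F' : it is a product of commutators
   (the inverse of a commutator [u,v] is the commutator [v,u]). *)
Definition in_Fder (w : word) : Prop :=
  exists s : seq (word * word),
    freeq w (flatten [seq wcomm x.1 x.2 | x <- s]).

(* w lies in [R, F], for R given by the predicate inR : it is a product of
   commutators [r, f] and their inverses [f, r] with r in R, f in F. *)
Definition in_commRF (inR : word -> Prop) (w : word) : Prop :=
  exists s : seq (word * word * bool),
    (forall x, x \in s -> inR x.1.1) /\
    freeq w (flatten [seq (if x.2 then wcomm x.1.1 x.1.2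
                           else wcomm x.1.2 x.1.1) | x <- s]).
End FreeWords.

(* Schur multiplier via the Hopf formula M(G) = (R cap F')/[R,F] for the     *)
(* standard free presentation F/R of G, where F is free on the set of        *)
(* elements of G and F -> G is the evaluation map.                           *)
Section Schur.
Variable gT : finGroupType.
Variable G : {group gT}.

Definition letter_val (l : subg_of G * bool) : gT :=
  if l.2 then sgval l.1 else ((sgval l.1)^-1)%g.

Definition weval (w : word (subg_of G)) : gT :=
  foldr (fun l acc => letter_val l * acc)%g 1%g w.

Definition in_Rel (w : word (subg_of G)) : Prop := weval w = 1%g.

Definition in_RFder (w : word (subg_of G)) : Prop := in_Rel w /\ in_Fder w.

Definition congRF (w1 w2 : word (subg_of G)) : Prop :=
  in_commRF in_Rel (winv w1 ++ w2).

Definition schur_multiplier_order (N : nat) : Prop :=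
  exists s : seq (word (subg_of G)),
    [/\ size s = N,
        (forall i, i < N -> in_RFder (nth [::] s i)),
        (forall i j, i < N -> j < N -> i <> j ->
            ~ congRF (nth [::] s i) (nth [::] s j))
      & (forall w, in_RFder w -> exists2 i, i < N & congRF (nth [::] s i) w)].
End Schur.

(* Main.v *)
(* Write G as a direct product of cyclic groups of orders p^l_0 >= ... >= p^l_(r-1),
   so that r = n - a and l_0 = e. Only the lower bound k >= sum_j j l_j on the
   Schur multiplier is needed. It comes from bilinear maps beta on G: the central
   extension with cocycle beta sends R to a central subgroup and kills [R, F],
   while a commutator [u, v] goes to beta(u, v) - beta(v, u); the maps
   beta_ij(g, h) = g_i h_j for i < j, with values in Z / p^l_j, separate
   prod_j p^(j l_j) elements of (R cap F') / [R, F]. The hypothesis on the exponent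
   then reads sum_(j >= 2) (j - 1) (l_j - 1) <= 0, so that l_j = 1 for j >= 2 and
   m = l_1 - 1. *)
Require Import Defs.
From HB Require Import structures.
From mathcomp Require Import all_boot all_order all_algebra all_fingroup all_solvable.
From mathcomp Require Import ring zify.

Set Implicit Arguments.
Unset Strict Implicit.
Unset Printing Implicit Defensive.

Import GRing.Theory.
Local Open Scope group_scope.

(** * Bilinear maps as invariants of words modulo [R, F] *)

Section WordCocycle.

Variables (gT : finGroupType) (G : {group gT}) (R : comNzRingType).
Variable beta : gT -> gT -> R.
Hypothesis betaMl : {in G & &, forall x y z, beta (x * y) z = (beta x z + beta y z)%R}.
Hypothesis betaMr : {in G & &, forall x y z, beta x (y * z) = (beta x y + beta x z)%R}.

Implicit Types (l : subg_of G * bool) (u v w : word (subg_of G)).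

Lemma letter_val_in l : letter_val l \in G.
Proof. by case: l => x [] /=; rewrite /letter_val /= ?groupV subgP. Qed.

Lemma letter_valN (x : subg_of G) (b : bool) :
  letter_val (x, ~~ b) = (letter_val (x, b))^-1.
Proof. by case: b; rewrite /letter_val //= invgK. Qed.

Lemma weval_in w : weval w \in G.
Proof. by elim: w => //= l w IHw; rewrite groupM ?letter_val_in. Qed.

Lemma weval_cat u v : weval (u ++ v) = weval u * weval v.
Proof. by elim: u => [|l u IHu] /=; rewrite ?mul1g // -mulgA -IHu. Qed.

Lemma winv_cons l w : winv (l :: w) = winv w ++ [:: (l.1, ~~ l.2)].
Proof. by rewrite /winv /= rev_cons cats1. Qed.

Lemma weval_winv w : weval (winv w) = (weval w)^-1.
Proof.
elim: w => [|[x b] w IHw]; first by rewrite invg1.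
by rewrite winv_cons weval_cat IHw /= letter_valN mulg1 invMg.
Qed.

Lemma weval_wcomm u v : weval (wcomm u v) = [~ weval u, weval v].
Proof. by rewrite /wcomm !weval_cat !weval_winv commgEl conjgE !mulgA. Qed.

Lemma beta1l y : y \in G -> beta 1 y = 0%R.
Proof.
by move=> Gy; apply: (addrI (beta 1 y)); rewrite -betaMl // mulg1 addr0.
Qed.

Lemma beta1r y : y \in G -> beta y 1 = 0%R.
Proof.
by move=> Gy; apply: (addrI (beta y 1)); rewrite -betaMr // mulg1 addr0.
Qed.

Lemma betaVl : {in G &, forall x y, beta x^-1 y = (- beta x y)%R}.
Proof.
move=> x y Gx Gy; apply: (addrI (beta x y)).
by rewrite -betaMl ?groupV // mulgV beta1l // subrr.
Qed.

Lemma betaVr : {in G &, forall x y, beta x y^-1 = (- beta x y)%R}.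
Proof.
move=> x y Gx Gy; apply: (addrI (beta x y)).
by rewrite -betaMr ?groupV // mulgV beta1r // subrr.
Qed.

(* In the central extension of G by R with multiplication
   (g, a) (h, b) = (g h, a + b + beta g h), send each generator x of the free
   group to (x, 0); then w is sent to (weval w, word_cocycle w), and
   letter_cocycle comes from (x, 0)^-1 = (x^-1, beta x x). *)
Definition letter_cocycle l : R := (if l.2 then 0 else beta (sgval l.1) (sgval l.1))%R.

Fixpoint word_cocycle w : R :=
  if w is l :: w' then
    (letter_cocycle l + beta (letter_val l) (weval w') + word_cocycle w')%R
  else 0%R.

(** The images of a letter and of its inverse multiply to (1, 0) in the extension, and
    [beta l l^-1 = - beta l l]. *)
Lemma letter_cocycleN (x : subg_of G) (b : bool) :
  (letter_cocycle (x, b) + letter_cocycle (x, ~~ b)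
   = beta (letter_val (x, b)) (letter_val (x, b)))%R.
Proof.
have Gx := subgP x; rewrite /letter_cocycle /letter_val.
by case: b; rewrite /= ?add0r ?addr0 // betaVl ?betaVr ?groupV // opprK.
Qed.

(** Multiplicativity of the map to the central extension, read on second components. *)
Lemma word_cocycle_cat u v :
  word_cocycle (u ++ v)
  = (word_cocycle u + word_cocycle v + beta (weval u) (weval v))%R.
Proof.
elim: u => [|l u IHu] /=; first by rewrite add0r beta1l ?weval_in ?addr0.
by rewrite weval_cat betaMr ?betaMl ?letter_val_in ?weval_in // IHu; ring.
Qed.

Lemma word_cocycle_freeq u v : freeq u v -> word_cocycle u = word_cocycle v.
Proof.
elim=> {u v} [_ _ [u v x b] | // | // | u v w _ -> _ //].
rewrite !word_cocycle_cat /= letter_valN mulKVg.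
have Gl := letter_val_in (x, b); have Gv := weval_in v.
rewrite betaMr ?betaVl ?betaVr ?groupV //.
(* Eliminating the cocycle of the inverse letter leaves a ring identity in values of [beta]. *)
by have /(canRL (addKr _))-> := letter_cocycleN x b; ring.
Qed.

Lemma word_cocycle_winv w :
  word_cocycle (winv w) = (beta (weval w) (weval w) - word_cocycle w)%R.
Proof.
elim: w => [|[x b] w IHw]; first by rewrite /= beta1l // subr0.
have Gl := letter_val_in (x, b); have Gw := weval_in w.
rewrite winv_cons word_cocycle_cat IHw weval_winv /= letter_valN mulg1.
rewrite beta1r ?betaVl ?betaVr ?betaMl ?betaMr ?groupV ?groupM //.
by have /(canRL (addKr _))-> := letter_cocycleN x b; ring.
Qed.

Lemma word_cocycle_wcomm u v :
  word_cocycle (wcomm u v)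
  = (beta (weval u) (weval v) - beta (weval v) (weval u))%R.
Proof.
have Gu := weval_in u; have Gv := weval_in v.
rewrite /wcomm !word_cocycle_cat !weval_cat !word_cocycle_winv !weval_winv.
rewrite ?(betaVl, betaVr, betaMl, betaMr, groupV, groupM) //.
by ring.
Qed.

Lemma word_cocycle_commRF w : in_commRF (@in_Rel gT G) w -> word_cocycle w = 0%R.
Proof.
case=> s [Rs /word_cocycle_freeq->].
suffices [] : word_cocycle (flatten [seq (if x.2 then wcomm x.1.1 x.1.2
     else wcomm x.1.2 x.1.1) | x <- s]) = 0%R /\
     weval (flatten [seq (if x.2 then wcomm x.1.1 x.1.2
     else wcomm x.1.2 x.1.1) | x <- s]) = 1 by [].
elim: s Rs => //= x s IHs Rs.
have [|IH1 IH2] := IHs; first by move=> y sy; apply: Rs; rewrite inE sy orbT.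
have /Rs: x \in x :: s by rewrite inE eqxx.
case: x {Rs} => [[r f] b] /= Rr.
case: b; rewrite !(word_cocycle_cat (wcomm _ _)) !(weval_cat (wcomm _ _)).
all: rewrite word_cocycle_wcomm weval_wcomm Rr IH1 IH2.
all: by rewrite ?comm1g ?commg1 !beta1r ?beta1l ?weval_in // !addr0 mulg1 subrr.
Qed.

(** This makes the cocycle an invariant of the classes that [schur_multiplier_order] counts. *)
Lemma word_cocycle_congRF u v :
  in_Rel u -> congRF u v -> word_cocycle u = word_cocycle v.
Proof.
move=> Ru /word_cocycle_commRF; rewrite word_cocycle_cat word_cocycle_winv.
rewrite weval_winv Ru invg1 !beta1l ?weval_in // sub0r addr0 addrC.
by move/eqP; rewrite subr_eq0 => /eqP.
Qed.

Lemma weval_wcomms (s : seq (word (subg_of G) * word (subg_of G))) :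
  abelian G -> weval (flatten [seq wcomm x.1 x.2 | x <- s]) = 1.
Proof.
move=> cGG; elim: s => //= x s IHs; rewrite weval_cat IHs weval_wcomm mulg1.
by apply/eqP/commgP/(centsP cGG); apply: weval_in.
Qed.

Lemma word_cocycle_wcomms (s : seq (word (subg_of G) * word (subg_of G))) :
  abelian G -> word_cocycle (flatten [seq wcomm x.1 x.2 | x <- s]) =
    (\sum_(x <- s) (beta (weval x.1) (weval x.2) - beta (weval x.2) (weval x.1)))%R.
Proof.
move=> cGG; elim: s => [|x s IHs] /=; first by rewrite big_nil.
rewrite word_cocycle_cat big_cons IHs weval_wcomms // beta1r ?weval_in // addr0.
by rewrite word_cocycle_wcomm.
Qed.

End WordCocycle.

(** The vector of cocycles is constant on classes, so it takes at most [N] values on R cap F'. Every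
    [f i] is such a value, attained at a product of commutators. *)
Lemma schur_multiplier_order_ge (gT : finGroupType) (G : {group gT})
    (R : comNzRingType) (I J : finType) (beta : J -> gT -> gT -> R)
    (f : I -> {ffun J -> R}) (N : nat) :
  (forall j, {in G & &, forall x y z, beta j (x * y) z = (beta j x z + beta j y z)%R}) ->
  (forall j, {in G & &, forall x y z, beta j x (y * z) = (beta j x y + beta j x z)%R}) ->
  abelian G -> schur_multiplier_order G N -> injective f ->
  (forall i, exists2 s : seq (gT * gT),
      {in s, forall x, x.1 \in G /\ x.2 \in G} &
      forall j, f i j = (\sum_(x <- s) (beta j x.1 x.2 - beta j x.2 x.1))%R) ->
  #|I| <= N.
Proof.
move=> bMl bMr cGG [s [sz_s Rs _ s_onto]] inj_f fP.
pose psi (w : word (subg_of G)) := [ffun j => word_cocycle (beta j) w].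
rewrite -sz_s -(size_map psi) cardE -(size_map f); apply: uniq_leq_size.
  by rewrite (map_inj_uniq inj_f) enum_uniq.
move=> _ /mapP[i _ ->]; have [t Gt ft] := fP i.
(* Group elements are lifted to one-letter words; the product of commutators [w] lies in R because G
   is abelian. *)
pose t' := [seq ([:: (subg G x.1, true)], [:: (subg G x.2, true)]) | x <- t].
pose w := flatten [seq wcomm x.1 x.2 | x <- t'].
have Rw: in_Rel w by apply: weval_wcomms.
have [k lt_kN cong_kw] : exists2 k, k < N & congRF (nth [::] s k) w.
  by apply: s_onto; split=> //; exists t'; apply: Relation_Operators.rst_refl.
apply/mapP; exists (nth [::] s k); first by rewrite mem_nth ?sz_s.
apply/ffunP=> j; rewrite ffunE.
rewrite (word_cocycle_congRF (bMl j) (bMr j) _ cong_kw); last by case: (Rs k lt_kN).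
rewrite (word_cocycle_wcomms (bMl j) (bMr j) t' cGG) ft big_map !big_seq.
apply: eq_bigr => x /Gt[Gx1 Gx2].
by rewrite /= /letter_val /= !mulg1 !subgK.
Qed.

(** * Coordinates on a product of cyclic groups, and the bound on the multiplier *)

Lemma abelian_prodgM (gT : finGroupType) (G : {group gT}) (I : Type) (s : seq I)
    (f g : I -> gT) :
  abelian G -> (forall i, f i \in G) -> (forall i, g i \in G) ->
  (\prod_(i <- s) f i) * (\prod_(i <- s) g i) = \prod_(i <- s) (f i * g i).
Proof.
move=> cGG Gf Gg; elim: s => [|i s IHs]; first by rewrite !big_nil mulg1.
rewrite !big_cons -IHs -!mulgA; congr (_ * _); rewrite !mulgA; congr (_ * _).
by apply: (centsP cGG); rewrite ?group_prod.
Qed.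

Section Coordinates.

Variables (gT : finGroupType) (G : {group gT}) (r : nat) (x : 'I_r -> gT).
Hypothesis defG : \big[dprod/1]_(i < r) <[x i]> = G.
Hypothesis cGG : abelian G.

(** The bound [#|G|] only makes the choice finite: exponents are not normalised, and entry i is
    meaningful only modulo [#[x i]]. *)
Definition dprod_coord (g : gT) : {ffun 'I_r -> 'I_#|G|.+1} :=
  odflt [ffun => ord0] [pick c : {ffun 'I_r -> 'I_#|G|.+1} | g == \prod_i x i ^+ c i].

Lemma dprod_gen_in i : x i \in G.
Proof.
rewrite -(bigdprodWY defG) -cycle_subG.
by apply: sub_gen; apply: (bigcup_max i).
Qed.

Lemma prod_dprod_coord g : g \in G -> g = \prod_i x i ^+ dprod_coord g i.
Proof.
rewrite /dprod_coord => Gg; case: pickP => [c /eqP //| no_c].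
have [c [cP gE _]] := mem_bigdprod defG Gg.
have c_ord i : exists n : 'I_#|G|.+1, c i == x i ^+ n.
  have [n lt_n ->] := cyclePmin (cP i isT).
  have le_n: n < #|G|.+1.
    by rewrite ltnS (leq_trans (ltnW lt_n)) ?subset_leq_card ?cycle_subG ?dprod_gen_in.
  by exists (Ordinal le_n).
have /negP[] := no_c [ffun i => xchoose (c_ord i)].
apply/eqP; rewrite {1}gE; apply: eq_bigr => i _.
by rewrite ffunE; apply/eqP/(xchooseP (c_ord i)).
Qed.

Lemma dprod_coord_uniq g (n : 'I_r -> nat) :
  g \in G -> g = \prod_i x i ^+ n i -> forall i, dprod_coord g i = n i %[mod #[x i]].
Proof.
move=> Gg gE i; have [c [_ _ c_uniq]] := mem_bigdprod defG Gg.
apply/eqP; rewrite -eq_expg_mod_order.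
have cE e : g = \prod_i x i ^+ e i -> x i ^+ e i = c i.
  by move=> ge; apply: (c_uniq (fun j => x j ^+ e j)) => // j _; apply: mem_cycle.
by rewrite (cE (fun j => dprod_coord g j)) ?(cE n) // -prod_dprod_coord.
Qed.

Lemma dprod_coordM : {in G &, forall g h i,
  dprod_coord (g * h) i = dprod_coord g i + dprod_coord h i %[mod #[x i]]}.
Proof.
move=> g h Gg Gh; apply: dprod_coord_uniq; first exact: groupM.
rewrite {1}(prod_dprod_coord Gg) {1}(prod_dprod_coord Gh).
rewrite (abelian_prodgM _ cGG); last by move=> i; rewrite groupX ?dprod_gen_in.
  by apply: eq_bigr => i _; rewrite expgD.
by move=> i; rewrite groupX ?dprod_gen_in.
Qed.

Lemma dprod_coordX i n j : dprod_coord (x i ^+ n) j = (i == j) * n %[mod #[x j]].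
Proof.
apply: (@dprod_coord_uniq _ (fun j => (i == j) * n)%N); first by rewrite groupX ?dprod_gen_in.
rewrite (big_only1 i) //= => [|k /negPf nki _]; first by rewrite eqxx mul1n.
by rewrite eq_sym nki mul0n.
Qed.

Hypothesis x_dvd : forall i j : 'I_r, i < j -> #[x j] %| #[x i].

Lemma schur_multiplier_order_abelian_ge N :
  schur_multiplier_order G N -> (\prod_i #[x i] ^ i)%N <= N.
Proof.
move=> schurN.
(* Any multiple of the exponent greater than 1 would do: 'Z_1 is a junk value. *)
pose q := (exponent G).*2.
have q_gt1 : 1 < q by rewrite /q; have := exponent_gt0 G; lia.
have dvd_q i : #[x i] %| q.
  by rewrite /q -muln2 dvdn_mulr ?dvdn_exponent ?dprod_gen_in.
have eqZ (m n : nat) : m = n %[mod q] -> (m%:R = n%:R :> 'Z_q)%R.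
  by move=> eq_mn; apply/val_inj; rewrite /= !val_Zp_nat.
(* The bound 1 forces [phi ij = 0] off the pairs i < j, so all pairs can serve as indices. *)
pose bd (ij : 'I_r * 'I_r) := if ij.1 < ij.2 then #[x ij.2] else 1%N.
(* All the groups Z / #[x j] are embedded in 'Z_q, by multiplication by q %/ #[x j]. *)
pose beta (ij : 'I_r * 'I_r) g h : 'Z_q :=
  if ij.1 < ij.2 then
    (q %/ #[x ij.2] * (dprod_coord g ij.1 * dprod_coord h ij.2))%:R%R
  else 0%R.
pose f (phi : {dffun forall ij, 'I_(bd ij)}) : {ffun 'I_r * 'I_r -> 'Z_q} :=
  [ffun ij => (q %/ #[x ij.2] * phi ij)%:R]%R.
have scale j m n : m = n %[mod #[x j]] ->
    ((q %/ #[x j] * m)%:R = (q %/ #[x j] * n)%:R :> 'Z_q)%R.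
  move=> eq_mn; apply: eqZ; rewrite -{2 4}(divnK (dvd_q j)).
  by rewrite -!muln_modr eq_mn.
(* By [x_dvd], the i-th coordinate also makes sense modulo [#[x j]], so [beta (i, j)] is
   bilinear. *)
have reduce (i j : 'I_r) m n :
    i < j -> m = n %[mod #[x i]] -> m = n %[mod #[x j]].
  by move=> /x_dvd dvd_ji eq_mn; rewrite -(modn_dvdm m dvd_ji) eq_mn modn_dvdm.
have betaX k l i j m n : beta (k, l) (x i ^+ m) (x j ^+ n) =
    if k < l then (q %/ #[x l] * ((i == k) * m * ((j == l) * n)))%:R%R else 0%R.
  rewrite /beta /=; case: ifP => // lt_kl; apply: scale; rewrite -modnMm.
  by rewrite (reduce _ _ _ _ lt_kl (dprod_coordX i m k)) dprod_coordX modnMm.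
(* For fixed j, exactly j indices i < j contribute a factor [#[x j]]. *)
have -> : (\prod_i #[x i] ^ i)%N = #|{dffun forall ij, 'I_(bd ij)}|.
  rewrite card_dep_ffun foldrE big_image /=.
  under [RHS]eq_bigr => ij _ do rewrite card_ord /bd.
  rewrite -(pair_bigA _ (fun i j : 'I_r => if i < j then #[x j] else 1%N)) /=.
  rewrite exchange_big /=; apply: eq_bigr => j _.
  rewrite -big_mkcond prod_nat_const; congr (_ ^ _)%N.
  by rewrite -sum1_card (big_ord_narrow (ltnW (ltn_ord j))) /= sum1_card card_ord.
apply: (@schur_multiplier_order_ge _ G _ _ _ beta f) => //.
- move=> [i j] g h k Gg Gh Gk; rewrite /beta /=; case: ifP => [lt_ij|_]; last by rewrite addr0.
  rewrite -natrD -mulnDr; apply: scale.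
  by rewrite -mulnDl -modnMml (reduce _ _ _ _ lt_ij (dprod_coordM Gg Gh i)) modnMml.
- move=> [i j] g h k Gg Gh Gk; rewrite /beta /=; case: ifP => [lt_ij|_]; last by rewrite addr0.
  rewrite -natrD -mulnDr; apply: scale.
  by rewrite -mulnDr -modnMmr dprod_coordM // modnMmr.
- move=> phi psi /ffunP eq_f; apply/ffunP=> ij; apply: val_inj => /=.
  have := congr1 val (eq_f ij); have := ltn_ord (phi ij); have := ltn_ord (psi ij).
  rewrite !ffunE /= !val_Zp_nat //.
  move: (nat_of_ord (phi ij)) (nat_of_ord (psi ij)) => m n; rewrite {1 2}/bd.
  case: ifP => [_ lt_n lt_m | _]; last by case: m n => [|//] [].
  have q'_gt0 : 0 < q %/ #[x ij.2] by rewrite divn_gt0 // dvdn_leq // ltnW.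
  have lt_q u : u < #[x ij.2] -> q %/ #[x ij.2] * u < q.
    by move=> lt_u; rewrite -{2}(divnK (dvd_q ij.2)) ltn_pmul2l.
  by rewrite !modn_small ?lt_q // => /eqP; rewrite eqn_pmul2l // => /eqP.
move=> phi.
have phi0 (i j : 'I_r) : ~~ (i < j) -> phi (i, j) = 0%N :> nat.
  move=> /negPf ge_ij; apply/eqP; rewrite -leqn0 -ltnS.
  by apply: leq_trans (ltn_ord (phi (i, j))) _; rewrite /bd /= ge_ij.
(* In the product of the commutators of [x i ^+ phi (i, j)] and [x j], the map [beta (k, l)] sees
   only the pair (k, l). *)
exists [seq (x ij.1 ^+ phi ij, x ij.2) | ij <- enum {:'I_r * 'I_r}].
  by move=> _ /mapP[ij _ ->]; rewrite groupX ?dprod_gen_in.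
move=> [k l]; rewrite big_map big_enum /= (big_only1 (k, l)) //=.
  rewrite ffunE -(expg1 (x l)) !betaX !eqxx /=; case: ltnP => [lt_kl | le_lk].
    rewrite (negPf (_ : l != k)) ?mul0n ?muln0 ?subr0 ?mul1n ?muln1 //.
    by rewrite -val_eqE /= gtn_eqF.
  by rewrite phi0 ?muln0 ?subrr // -leqNgt.
move=> [i j] ne_ij_kl _; rewrite -(expg1 (x j)) !betaX.
case: ifP => [/= lt_kl | _]; last by rewrite subrr.
have -> : ((i == k) * phi (i, j) * ((j == l) * 1) = 0)%N.
  by move: ne_ij_kl; rewrite xpair_eqE; do 2!case: eqP => //; rewrite ?muln0.
(* A nonzero swapped term would need j = k < l = i, where [phi (i, j)] is 0. *)
have -> : ((j == k) * 1 * ((i == l) * phi (i, j)) = 0)%N.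
  case: eqP => // ->; case: eqP => // ->.
  by rewrite phi0 ?muln0 // -leqNgt ltnW.
by rewrite subrr.
Qed.

End Coordinates.

(** * Isomorphisms with the concrete groups *)

Lemma isog_dprod_setT (gT aT bT : finGroupType) (A B G : {group gT}) :
  A \x B = G -> A \isog [set: aT] -> B \isog [set: bT] -> G \isog [set: aT * bT].
Proof.
move=> defG isoA isoB.
have defT : setX [set: aT] 1 \x setX 1 [set: bT] = [set: aT * bT].
  by rewrite setX_dprod; apply/setP=> u; rewrite !inE.
apply: (isog_dprod defG defT).
  by apply: isog_trans isoA _; rewrite /= -morphim_pairg1 sub_isog ?injm_pairg1.
by apply: isog_trans isoB _; rewrite /= -morphim_pair1g sub_isog ?injm_pair1g.
Qed.

Lemma isog_cycle_Zp (gT : finGroupType) (x : gT) :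
  1 < #[x] -> <[x]> \isog [set: 'Z_(#[x])].
Proof.
move=> x_gt1; rewrite isog_cyclic_card ?cycle_cyclic //= Zp_cycle cycle_cyclic /=.
by rewrite -Zp_cycle cardsT card_ord Zp_cast.
Qed.

Lemma isog_abelem_rowZp (gT : finGroupType) (p c : nat) (E : {group gT}) :
  prime p -> p.-abelem E -> #|E| = (p ^ c)%N -> E \isog [set: 'rV['Z_p]_c].
Proof.
move=> p_pr abelE cardE; rewrite (isog_abelem_card _ abelE) cardE cardsT card_mx.
rewrite mul1n card_ord Zp_cast ?prime_gt1 // eqxx andbT abelemE //.
rewrite FinRing.zmod_abelian; apply/exponentP=> v _; rewrite FinRing.zmodXgE -scaler_nat.
by rewrite pchar_Zp ?prime_gt1 // scale0r.
Qed.

Lemma dprod_cycle_abelem (gT : finGroupType) (p : nat) (b : seq gT) (E : {group gT}) :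
  prime p -> \big[dprod/1]_(x <- b) <[x]> = E -> {in b, forall x, #[x] = p} ->
  p.-abelem E /\ #|E| = (p ^ size b)%N.
Proof.
move=> p_pr; elim: b E => [|x b IHb] E; first by rewrite big_nil => <- _; rewrite abelem1 cards1.
rewrite big_cons => defE; case/dprodP: (defE) => [[K H defK defH]] _ _ _ ordb.
rewrite defH in defE; have [] := IHb H defH; first by move=> y sy; apply: ordb; rewrite inE sy orbT.
move=> abH cH; have ox : #[x] = p by apply: ordb; rewrite inE eqxx.
rewrite (dprod_abelem _ defE) -(dprod_card defE) abH cH prime_abelem //.
by rewrite -orderE ox expnS.
Qed.

(** * Invariants of abelian groups *)

Lemma head_abelian_type (gT : finGroupType) (G : {group gT}) :
  abelian G -> G :!=: 1 -> head 0%N (abelian_type G) = exponent G.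
Proof.
(* The recursion has fuel [#|G|], which is positive; one step exposes the exponent as first
   entry. *)
move=> cGG ntG; rewrite /abelian_type genGidG -(prednK (cardG_gt0 G)) /=.
by case: ifP => //; rewrite cGG ntG.
Qed.

(** The number of factors is the rank, the logarithm of the order of Ohm_1; Phi is Mho^1, and their
    orders multiply to [#|G|]. *)
Lemma size_abelian_type_Phi (gT : finGroupType) (p n a : nat) (G : {group gT}) :
  prime p -> p.-group G -> abelian G -> #|G| = (p ^ n)%N -> #|'Phi(G)| = (p ^ a)%N ->
  (size (abelian_type G) + a = n)%N.
Proof.
move=> p_pr pG cGG oG oPhi; rewrite size_abelian_type // (rank_pgroup pG) p_rank_abelian //.
have := mul_card_Ohm_Mho_abelian 1 cGG; rewrite -(Phi_Mho pG cGG) oPhi oG.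
move/(congr1 (logn p)); rewrite lognM ?cardG_gt0 ?expn_gt0 ?prime_gt0 //.
by rewrite !pfactorK.
Qed.

(** * Arithmetic of the exponents *)

Lemma double_sum_succ c : (2 * \sum_(i < c) i.+1 = c * c.+1)%N.
Proof. by elim: c => [|c IHc]; rewrite ?big_ord0 // big_ord_recr /= mulnDr IHc; lia. Qed.

(** Here [s] lists l_2, l_3, ..., whence the weight [i.+2]. Removing [sumn s] bounds the sum of the
    (i + 1) s_i by that of the i + 1; as s_i >= 1, equality holds termwise. *)
Lemma eq1_of_weighted_sum (s : seq nat) :
  {in s, forall i, 0 < i} ->
  \sum_(i < size s) i.+2 * nth 0%N s i <= sumn s + \sum_(i < size s) i.+1 ->
  {in s, forall i, i = 1%N}.
Proof.
move=> s_gt0; rewrite sumnE (big_nth 0%N) big_mkord => le_sum.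
have [le_w eq_w] : \sum_(i < size s) i.+1 <= \sum_(i < size s) i.+1 * nth 0%N s i
    ?= iff [forall i : 'I_(size s), nth 0%N s i == 1%N].
  apply: leqif_sum => i _; have := s_gt0 _ (mem_nth 0%N (ltn_ord i)).
  by case: (nth _ _ _) => // m _; split; [rewrite leq_pmulr | nia].
move: le_sum; under eq_bigr => i _ do rewrite mulSn.
rewrite big_split leq_add2l /= => ge_w.
move: eq_w; rewrite eqn_leq le_w ge_w => /esym/forallP eq1.
by move=> _ /(nthP 0%N)[i lt_i <-]; apply/eqP/(eq1 (Ordinal lt_i)).
Qed.

(** * Determination of the type of G *)

Unset Implicit Arguments.
Set Strict Implicit.
Set Printing Implicit Defensive.

Theorem theorem2p3 (p n a k e : nat) (gT : finGroupType) (G : {group gT}) :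
  prime p -> abelian G -> p.-group G -> #|G| = (p ^ n)%N ->
  schur_multiplier_order G (p ^ k) ->
  #|'Phi(G)| = (p ^ a)%N ->
  let t : int := (((n * (n - 1)) %/ 2)%N%:Z - k%:Z)%R in
  let m : int := ((a * n)%N%:Z - ((a * (a + 1)) %/ 2)%N%:Z - t)%R in
  (a + 2 <= n)%N ->
  (e%:Z = a%:Z - m + 1)%R ->
  exponent G = (p ^ e)%N ->
  G \isog [set: 'Z_(p ^ e) * 'Z_(p ^ `|(m + 1)%R|%N) * 'rV['Z_p]_(n - a - 2)].
Proof.
move=> p_pr cGG pG oG schurG oPhi t m le_an eE expG.
have p_gt1 := prime_gt1 p_pr.
have [b defG ord_b] := abelian_structure cGG.
have sz_b : (size b + a = n)%N.
  by rewrite -(size_abelian_type_Phi p_pr pG cGG oG oPhi) -ord_b size_map.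
have ntG : G :!=: 1.
  by rewrite -cardG_gt1 oG -(expn0 p) ltn_exp2l //; lia.
(* This stays in the goal until [b] is split, and becomes [ord_x0]. *)
have := head_abelian_type cGG ntG; rewrite -ord_b expG.
have gt1_b : {in b, forall x, 1 < #[x]}.
  by move=> x bx; apply: (allP (abelian_type_gt1 G)); rewrite -ord_b map_f.
have defG' : \big[dprod/1]_(i < size b) <[nth 1 b i]> = G.
  by move: defG; rewrite (big_nth 1) big_mkord.
have b_in : {in b, forall x, x \in G}.
  by move=> _ /(nthP 1)[i lt_i <-]; apply: (dprod_gen_in defG' (Ordinal lt_i)).
have pow_b : {in b, forall x, #[x] = (p ^ logn p #[x])%N}.
  by move=> x /b_in Gx; rewrite -p_part part_pnat_id //; apply: mem_p_elt pG Gx.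
have lt_b : forall i j, i < j -> j < size b -> #[nth 1 b j] %| #[nth 1 b i].
  move=> i j lt_ij lt_j; have := abelian_type_dvdn_sorted G; rewrite -ord_b => srt.
  have tr : transitive [rel m n | n %| m] by move=> u v w /= vu wu; apply: dvdn_trans wu vu.
  have := sorted_ltn_nth tr 0%N srt.
  move/(_ i j); rewrite !inE size_map => /(_ (ltn_trans lt_ij lt_j) lt_j lt_ij).
  by rewrite !(nth_map 1) // (ltn_trans lt_ij).
have schur_ge : (\prod_(i < size b) #[nth 1%g b i] ^ i)%N <= p ^ k.
  apply: (schur_multiplier_order_abelian_ge defG' cGG) schurG => i j lt_ij.
  exact: lt_b.
case: b => [|x0 [|x1 b]] in {lt_b defG'} defG ord_b sz_b gt1_b b_in pow_b schur_ge *;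
  try by move: sz_b => /=; lia.
move=> /= ord_x0; pose s := [seq logn p #[x] | x <- b].
have x1b : x1 \in [:: x0, x1 & b] by rewrite !inE eqxx orbT.
have sub_b : {subset b <= [:: x0, x1 & b]} by move=> x bx; rewrite !inE bx !orbT.
pose l1 := logn p #[x1].
have ord_x1 : #[x1] = (p ^ l1)%N by apply: pow_b.
have l1_gt0 : 0 < l1 by rewrite -(ltn_exp2l 0 _ p_gt1) -ord_x1 gt1_b.
have s_gt0 : {in s, forall i, 0 < i}.
  move=> _ /mapP[x /sub_b bx ->].
  by rewrite -(ltn_exp2l 0 _ p_gt1) -pow_b // gt1_b.
have nE : (n = e + (l1 + sumn s))%N.
  apply/(expnI p_gt1); rewrite -oG -(bigdprod_card defG) !big_cons -!orderE ord_x0 ord_x1.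
  rewrite !expnD; congr (_ * (_ * _))%N; rewrite sumnE big_map expn_sum.
  by apply: eq_big_seq => x /sub_b bx; rewrite -orderE -pow_b.
(* The factor of index 0 contributes 1 and that of index 1 contributes [p ^ l1]; entry i of [s] has
   index i + 2. *)
have le_k : l1 + \sum_(i < size s) i.+2 * nth 0%N s i <= k.
  rewrite -(leq_exp2l _ _ p_gt1); apply: leq_trans schur_ge; rewrite /= 2!big_ord_recl.
  rewrite /= expn0 mul1n expn1 expnD ord_x1 leq_mul2l size_map expn_sum; apply/orP; right.
  apply: leq_prod => i _; rewrite /= (nth_map 1) // mulnC expnM -pow_b //.
  by apply/sub_b/mem_nth.
have size_s : (size s + 2 + a = n)%N by move: sz_b; rewrite size_map /=; lia.
have dbl := double_sum_succ (size s).
have half_n : (2 * (n * (n - 1) %/ 2) = n * (n - 1))%N.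
  by rewrite mulnC divnK // dvdn2 oddM oddB ?andbN //; lia.
have half_a : (2 * (a * (a + 1) %/ 2) = a * (a + 1))%N.
  by rewrite mulnC divnK // dvdn2 oddM oddD addbT andbN.
(* The first equation is [eE] with e taken from [nE]. The definitions of t and m give k = (n - a)(n
   - a - 1)/2 + m, hence the second. Naming the products makes the problem linear. *)
have [mE kE] : m = (l1%:Z + (sumn s)%:Z - (size s)%:Z - 1)%R /\
    k = (l1 + sumn s + \sum_(i < size s) i.+1)%N.
  move: dbl half_n half_a eE; rewrite /m /t.
  move: (\sum_(i < size s) i.+1) (n * (n - 1) %/ 2) (a * (a + 1) %/ 2) => W T1 T2.
  have -> : (n * (n - 1) = size s * size s + 3 * size s + 2 + 2 * (a * size s)
    + 3 * a + a * a)%N by rewrite -size_s addnS -addSnnS subn1 /=; lia.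
  have -> : (a * n = a * size s + 2 * a + a * a)%N by rewrite -size_s; lia.
  rewrite mulnS mulnDr muln1.
  by move: (a * a)%N (a * size s)%N (size s * size s)%N => aa ac cc; split; lia.
have s_eq1 : {in s, forall i, i = 1%N}.
  by apply: eq1_of_weighted_sum s_gt0 _; move: le_k; rewrite kE -addnA leq_add2l.
have s_sum : sumn s = size s.
  by rewrite sumnE -sum1_size; apply: eq_big_seq.
have l1E : `|(m + 1)%R|%N = l1 by rewrite mE s_sum; lia.
rewrite l1E -ord_x0 -ord_x1.
have -> : (n - a - 2 = size b)%N by move: sz_b => /=; lia.
move: defG; rewrite !big_cons dprodA => defG.
case/dprodP: (defG) => [[K E defK defE]] _ _ _.
rewrite defK defE in defG.
have ord_p : {in b, forall x, #[x] = p}.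
  by move=> x bx; rewrite pow_b ?sub_b // (s_eq1 _ (map_f _ bx)) expn1.
have [abE oE] := dprod_cycle_abelem p_pr defE ord_p.
apply: isog_dprod_setT defG _ (isog_abelem_rowZp p_pr abE oE).
apply: isog_dprod_setT defK _ _; apply: isog_cycle_Zp; apply: gt1_b => //.
by rewrite inE eqxx.
Qed.
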